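(* Let $A\in\mathbb R^{m\times N}$, $y\in\mathbb R^m$, $\lambda_1,\lambda_2>0$, and consider the sparse fused LASSO subject to the nonnegative constraint: $$\min_{x\in\mathbb R^N}\ \|Ax-y\|_2^2+\lambda_1\|x\|_1+\lambda_2\|D_1x\|_1\quad\text{subject to}\quad x\ge0.$$ For a feasible point $x^*$, let $E$, $\mathcal S$, $\mathcal S_I$, $\mathcal S_D$, $b$ be as defined in the context. Then $x^*$ is the unique minimizer if and only if the following conditions hold: (i) $\begin{bmatrix} A_{\bullet\mathcal S_I} \\ (D_1)_{\mathcal S_D^c\mathcal S_I} \end{bmatrix}$ has full column rank; (ii) there exist $u\in\mathbb R^m$, $u'\in\mathbb R^{|\mathcal S_I^c|}_{++}$, and $u''\in\mathbb R^{|\mathcal S^c|}$ with $\|u''\|_\infty<1$ such that $$\begin{pmatrix} A_{\bullet\mathcal S_I}^Tu \\ A_{\bullet\mathcal S_I^c}^Tu+u' \end{pmatrix}-E_{\mathcal S^c\bullet}^Tu''=b,$$ where the two blocks of the first vector are its subvectors indexed by $\mathcal S_I$ and $\mathcal S_I^c$, respectively; (iii) there exist $\widetilde u\in\mathbb R^{|\mathcal S_I^c|}_+$ and $\widetilde u'\in\mathbb R^{|\mathcal S^c|}$ with $\|\widetilde u'\|_\infty\le1$ such that $2A^T(Ax^*-y)-I_{\mathcal S_I^c\bullet}^T\widetilde u+b+E_{\mathcal S^c\bullet}^T\widetilde u'=0$.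
   Context: $D_1\in\mathbb R^{(N-1)\times N}$ is the first-order difference matrix, $(D_1x)_i=x_{i+1}-x_i$. $I=I_N$ is the identity matrix and $E:=\begin{bmatrix} \lambda_1 I_N \\ \lambda_2 D_1 \end{bmatrix}\in\mathbb R^{(2N-1)\times N}$. Given $x^*$: $\mathcal S$, $\mathcal S_I$, $\mathcal S_D$ are the supports (index sets of nonzero entries) of $Ex^*$, $x^*$, $D_1x^*$ respectively, with complements $\mathcal S^c\subseteq\{1,\ldots,2N-1\}$, $\mathcal S_I^c\subseteq\{1,\ldots,N\}$, $\mathcal S_D^c\subseteq\{1,\ldots,N-1\}$; $\widehat b:=\mathrm{sgn}((Ex^* )_{\mathcal S})$ (componentwise sign) and $b:=E_{\mathcal S\bullet}^T\widehat b\in\mathbb R^N$. For a matrix $M$, $M_{\beta\bullet}$, $M_{\bullet\beta}$, $M_{\beta\gamma}$ denote the submatrices with rows in $\beta$, columns in $\beta$, and rows in $\beta$ and columns in $\gamma$. $\mathbb R^n_+$, $\mathbb R^n_{++}$ are the nonnegative and (strictly) positive orthants. A matrix with no columns is regarded as having full column rank. *)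

(* Defs.v *)
From HB Require Import structures.
From mathcomp Require Import all_boot all_order all_algebra.
From mathcomp Require Import reals matrix_normedtype.

Set Implicit Arguments.
Unset Strict Implicit.
Unset Printing Implicit Defensive.

Import Order.TTheory GRing.Theory Num.Theory.
Local Open Scope ring_scope.

Section Submatrices.
Context {R : realType}.

(* M_{β•}, M_{•γ}, M_{βγ}: the rows and columns kept are renumbered in
   increasing order by enum_val. *)
Definition rows {p q : nat} (beta : {set 'I_p}) (M : 'M[R]_(p, q)) :
  'M[R]_(#|beta|, q) :=
  rowsub (fun i : 'I_#|beta| => enum_val i) M.

Definition cols {p q : nat} (gamma : {set 'I_q}) (M : 'M[R]_(p, q)) :
  'M[R]_(p, #|gamma|) :=
  colsub (fun j : 'I_#|gamma| => enum_val j) M.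

Definition submat {p q : nat} (beta : {set 'I_p}) (gamma : {set 'I_q})
  (M : 'M[R]_(p, q)) : 'M[R]_(#|beta|, #|gamma|) := rows beta (cols gamma M).

(* The vector w with w_β = v and w_{β^c} = v', see rows_assemble and
   rowsC_assemble. *)
Definition assemble {n : nat} (beta : {set 'I_n})
  (v : 'cV[R]_#|beta|) (v' : 'cV[R]_#|~: beta|) : 'cV[R]_n :=
  (rows beta 1%:M)^T *m v + (rows (~: beta) 1%:M)^T *m v'.

Definition supp {n : nat} (x : 'cV[R]_n) : {set 'I_n} :=
  [set i | x i 0 != 0].

Definition full_column_rank {p q : nat} (M : 'M[R]_(p, q)) : Prop :=
  \rank M = q.

Lemma rows_mul {n q r : nat} (beta : {set 'I_n}) (M : 'M[R]_(n, q))
    (B : 'M[R]_(q, r)) :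
  rows beta M *m B = rows beta (M *m B).
Proof.
by apply/matrixP => i j; rewrite !mxE; apply: eq_bigr => k _; rewrite mxE.
Qed.

Lemma rows_eye_trmx {n : nat} (beta : {set 'I_n}) :
  rows beta 1%:M *m (rows beta (1%:M : 'M[R]_n))^T = 1%:M.
Proof.
rewrite rows_mul mul1mx; apply/matrixP => i j.
by rewrite !mxE (inj_eq enum_val_inj) eq_sym.
Qed.

Lemma rows_eye_disjoint {n : nat} (beta gamma : {set 'I_n}) :
  [disjoint beta & gamma] ->
  rows beta 1%:M *m (rows gamma (1%:M : 'M[R]_n))^T = 0.
Proof.
move=> dis; rewrite rows_mul mul1mx; apply/matrixP => i j.
rewrite !mxE; case: eqP => // e; have := enum_valP i.
by rewrite -e => /(disjointFr dis); rewrite enum_valP.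
Qed.

Lemma rows_assemble {n : nat} (beta : {set 'I_n}) v v' :
  rows beta (assemble v v') = v.
Proof.
rewrite /assemble -[LHS]mul1mx -[X in rows _ X]mul1mx -rows_mul mulmxDr.
rewrite !mulmxA rows_eye_trmx mul1mx rows_eye_disjoint ?mul0mx ?addr0 ?mul1mx//.
by rewrite -setI_eq0 setICr.
Qed.

Lemma rowsC_assemble {n : nat} (beta : {set 'I_n}) v v' :
  rows (~: beta) (@assemble n beta v v') = v'.
Proof.
rewrite /assemble -[LHS]mul1mx -[X in rows _ X]mul1mx -rows_mul mulmxDr.
rewrite !mulmxA rows_eye_trmx mul1mx rows_eye_disjoint ?mul0mx ?add0r ?mul1mx//.
by rewrite -setI_eq0 setIC setICr.
Qed.

End Submatrices.

Section FusedLasso.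
Context {R : realType}.

Definition D1 (N : nat) : 'M[R]_(N.-1, N) :=
  \matrix_(i, j) ((j == i.+1 :> nat)%:R - (j == i :> nat)%:R).

Lemma D1_mulE (n : nat) (x : 'cV[R]_n.+1) (i : 'I_n) :
  (D1 n.+1 *m x) i 0 = x (lift ord0 i) 0 - x (widen_ord (leqnSn n) i) 0.
Proof.
rewrite mxE; under eq_bigr do rewrite mxE mulrBl.
rewrite sumrB (bigD1 (lift ord0 i)) //= eqxx mul1r big1 ?addr0.
  rewrite (bigD1 (widen_ord (leqnSn n) i)) //= eqxx mul1r big1 ?addr0 // => j.
  by rewrite -val_eqE /= => /negPf->; rewrite mul0r.
by move=> j; rewrite -val_eqE /= => /negPf->; rewrite mul0r.
Qed.

Definition fusedE (N : nat) (l1 l2 : R) : 'M[R]_(N + N.-1, N) :=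
  col_mx (l1 *: 1%:M) (l2 *: D1 N).

Definition norm1 {n : nat} (v : 'cV[R]_n) : R := \sum_i `|v i 0|.

Definition norm2 {n : nat} (v : 'cV[R]_n) : R :=
  Num.sqrt (\sum_i v i 0 ^+ 2).

(* On matrices, `|M| is the entrywise maximum norm (0 if M has no entries). *)
Definition norm_inf {n : nat} (v : 'cV[R]_n) : R := `|v|.

Definition nonneg {n : nat} (v : 'cV[R]_n) : Prop := forall i, 0 <= v i 0.
Definition pos {n : nat} (v : 'cV[R]_n) : Prop := forall i, 0 < v i 0.

Definition objective {m N : nat} (A : 'M[R]_(m, N)) (y : 'cV[R]_m)
  (l1 l2 : R) (x : 'cV[R]_N) : R :=
  norm2 (A *m x - y) ^+ 2 + l1 * norm1 x + l2 * norm1 (D1 N *m x).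

Definition minimizer {m N : nat} (A : 'M[R]_(m, N)) (y : 'cV[R]_m)
  (l1 l2 : R) (x : 'cV[R]_N) : Prop :=
  nonneg x /\
  forall z, nonneg z -> objective A y l1 l2 x <= objective A y l1 l2 z.

Definition unique_minimizer {m N : nat} (A : 'M[R]_(m, N)) (y : 'cV[R]_m)
  (l1 l2 : R) (x : 'cV[R]_N) : Prop :=
  minimizer A y l1 l2 x /\ forall z, minimizer A y l1 l2 z -> z = x.

End FusedLasso.

(* Main.v *)
(** Write the objective as a quadratic plus the polyhedral function
    g(x) = |E x|_1.  Its one-sided directional derivative at xs along d is
    g'(d) = <b, d> + |(E d)_{S^c}|_1; one has g(xs + d) >= g(xs) + g'(d), with
    equality for small d.  Hence xs is a minimizer iff
    <2 A^T(A xs - y), d> + g'(d) >= 0 on the cone d_{SI^c} >= 0, and it is the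
    unique one iff moreover g'(d) > 0 for every nonzero d of this cone in the
    kernel of A.  Introducing slacks s >= |(E d)_{S^c}| turns these into linear
    inequalities: Farkas' lemma gives (iii), and a variant of it with strictly
    positive multipliers gives (ii).  Condition (i) says that d = 0 is the only
    solution of A d = 0, d_{SI^c} = 0, (E d)_{S^c} = 0. *)
Require Import Defs.
From mathcomp Require Import all_boot all_order all_algebra.
From mathcomp Require Import reals boolp matrix_normedtype.
From mathcomp Require Import ring lra.
Import Order.TTheory GRing.Theory Num.Theory.
Local Open Scope ring_scope.

(** * Inner product and norms of column vectors *)

Section Dot.
Context {R : realType}.

Definition dot {n : nat} (u v : 'cV[R]_n) : R := (u^T *m v) 0 0.

Lemma dotE {n : nat} (u v : 'cV[R]_n) : dot u v = \sum_i u i 0 * v i 0.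
Proof. by rewrite /dot mxE; apply: eq_bigr => i _; rewrite mxE. Qed.

Lemma dotDl {n : nat} (u v w : 'cV[R]_n) : dot (u + v) w = dot u w + dot v w.
Proof. by rewrite /dot linearD mulmxDl mxE. Qed.

Lemma dotNl {n : nat} (u v : 'cV[R]_n) : dot (- u) v = - dot u v.
Proof. by rewrite /dot linearN mulNmx mxE. Qed.

Lemma dotZl {n : nat} (a : R) (u v : 'cV[R]_n) : dot (a *: u) v = a * dot u v.
Proof. by rewrite /dot linearZ -scalemxAl mxE. Qed.

Lemma dotDr {n : nat} (u v w : 'cV[R]_n) : dot u (v + w) = dot u v + dot u w.
Proof. by rewrite /dot mulmxDr mxE. Qed.

Lemma dotNr {n : nat} (u v : 'cV[R]_n) : dot u (- v) = - dot u v.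
Proof. by rewrite /dot mulmxN mxE. Qed.

Lemma dotZr {n : nat} (a : R) (u v : 'cV[R]_n) : dot u (a *: v) = a * dot u v.
Proof. by rewrite /dot -scalemxAr mxE. Qed.

Lemma dot0r {n : nat} (u : 'cV[R]_n) : dot u 0 = 0.
Proof. by rewrite /dot mulmx0 mxE. Qed.

Lemma dotC {n : nat} (u v : 'cV[R]_n) : dot u v = dot v u.
Proof. by rewrite !dotE; apply: eq_bigr => i _; rewrite mulrC. Qed.

Lemma dot_trmx_mull {p q : nat} (M : 'M[R]_(p, q)) (u : 'cV_p) (v : 'cV_q) :
  dot (M^T *m u) v = dot u (M *m v).
Proof. by rewrite /dot trmx_mul trmxK mulmxA. Qed.

Lemma dot_col_mx {p q : nat} (u : 'cV[R]_p) (v : 'cV_q) (d : 'cV_p)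
    (s : 'cV_q) :
  dot (col_mx u v) (col_mx d s) = dot u d + dot v s.
Proof. by rewrite /dot tr_col_mx mul_row_col mxE. Qed.

Lemma nonneg_col_mx {p q : nat} (u : 'cV[R]_p) (v : 'cV[R]_q) :
  nonneg u -> nonneg v -> nonneg (col_mx u v).
Proof.
move=> u0 v0 i.
by case: (split_ordP i) => j ->; rewrite (col_mxEu, col_mxEd).
Qed.

Lemma dot_ge0 {n : nat} (u v : 'cV[R]_n) : nonneg u -> nonneg v -> 0 <= dot u v.
Proof. by move=> u0 v0; rewrite dotE sumr_ge0// => i _; rewrite mulr_ge0. Qed.

Lemma dot_pos_eq0 {n : nat} (u v : 'cV[R]_n) :
  pos u -> nonneg v -> dot u v <= 0 -> v = 0.
Proof.
move=> u0 v0 uv; apply/matrixP => i j; rewrite ord1 mxE.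
have /eqP : dot u v = 0.
  by apply/eqP; rewrite eq_le uv dot_ge0// => k; exact: ltW.
rewrite dotE psumr_eq0 => [/allP/(_ i)|k _]; last first.
  by rewrite mulr_ge0// ltW.
by rewrite mem_index_enum mulf_eq0 gt_eqF// => /(_ isT)/eqP.
Qed.

Lemma dot_self_ge0 {n : nat} (u : 'cV[R]_n) : 0 <= dot u u.
Proof. by rewrite dotE sumr_ge0// => i _; rewrite -expr2 sqr_ge0. Qed.

Lemma dot_self_le0 {n : nat} (u : 'cV[R]_n) : dot u u <= 0 -> u = 0.
Proof.
move=> uu; apply/matrixP => i j; rewrite ord1 mxE.
have /eqP : dot u u = 0 by apply/eqP; rewrite eq_le uu dot_self_ge0.
rewrite dotE psumr_eq0 => [/allP/(_ i)|k _]; last by rewrite -expr2 sqr_ge0.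
by rewrite mem_index_enum mulf_eq0 orbb => /(_ isT)/eqP.
Qed.

Lemma norm2_sqr {n : nat} (u : 'cV[R]_n) : norm2 u ^+ 2 = dot u u.
Proof.
rewrite /norm2 sqr_sqrtr ?dotE; first by apply: eq_bigr => i _; rewrite expr2.
by apply: sumr_ge0 => i _; rewrite sqr_ge0.
Qed.

Lemma norm1_ge0 {n : nat} (v : 'cV[R]_n) : 0 <= norm1 v.
Proof. exact: sumr_ge0. Qed.

Lemma norm1_eq0 {n : nat} (v : 'cV[R]_n) : norm1 v <= 0 -> v = 0.
Proof.
move=> v0; apply/matrixP => i j; rewrite ord1 mxE.
have /eqP : norm1 v = 0 by apply/eqP; rewrite eq_le v0 norm1_ge0.
by rewrite psumr_eq0// => /allP/(_ i (mem_index_enum _))/=; rewrite normr_eq0 => /eqP.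
Qed.

Lemma norm1Z {n : nat} (a : R) (v : 'cV[R]_n) : norm1 (a *: v) = `|a| * norm1 v.
Proof.
by rewrite /norm1 mulr_sumr; apply: eq_bigr => i _; rewrite mxE normrM.
Qed.

Lemma norm1_col_mx {p q : nat} (u : 'cV[R]_p) (v : 'cV[R]_q) :
  norm1 (col_mx u v) = norm1 u + norm1 v.
Proof.
rewrite /norm1 big_split_ord /=; congr (_ + _).
  by apply: eq_bigr => i _; rewrite col_mxEu.
by apply: eq_bigr => i _; rewrite col_mxEd.
Qed.

Lemma normr_entry_le {n : nat} (v : 'cV[R]_n) i : `|v i 0| <= norm_inf v.
Proof.
rewrite -[norm_inf v]/(mx_norm v) mx_normrE; apply/bigmax_geP; right => /=.
by exists (i, 0).
Qed.

(** The maximum behind [norm_inf] starts from 0; the sign condition on [a] covers a vector without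
    entries. *)
Lemma norm_inf_le {n : nat} (a : R) (v : 'cV[R]_n) :
  0 <= a -> (forall i, `|v i 0| <= a) -> norm_inf v <= a.
Proof.
move=> a0 va; rewrite -[norm_inf v]/(mx_norm v) mx_normrE; apply/bigmax_leP.
by split => //= -[i j] _ /=; rewrite ord1.
Qed.

Lemma norm_inf_lt {n : nat} (a : R) (v : 'cV[R]_n) :
  0 < a -> (forall i, `|v i 0| < a) -> norm_inf v < a.
Proof.
move=> a0 va; rewrite -[norm_inf v]/(mx_norm v) mx_normrE; apply/bigmax_ltP.
by split => //= -[i j] _ /=; rewrite ord1.
Qed.

(** Hölder's inequality for the dual pair of sup norm and 1-norm. *)
Lemma dot_le_norm {n : nat} (u v : 'cV[R]_n) : dot u v <= norm_inf u * norm1 v.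
Proof.
rewrite dotE mulr_sumr; apply: ler_sum => i _.
rewrite (le_trans (ler_norm _))// normrM ler_wpM2r// normr_entry_le//.
Qed.

End Dot.

(** * Farkas' lemma and its variant with positive multipliers *)

Section Farkas.
Context {R : realType}.

(* Bartl's induction: if the first inequality (with functional a) cannot be
   dropped, there is x0 with B x0 >= 0 and c x0 < 0, normalised so that
   a x0 = -1; composing with the projection d |-> d + (a d) x0 onto the kernel
   of a removes it. *)
Lemma farkas {k n : nat} (M : 'M[R]_(k, n)) (c : 'cV[R]_n) :
  (forall d, nonneg (M *m d) -> 0 <= dot c d) ->
  exists2 w, nonneg w & c = M^T *m w.
Proof.
elim: k => [|k IH] in n M c *.
  (* Without rows every direction is admissible, and testing [- c] forces [c = 0]. *)
  move=> Mc; exists 0 => [i|]; first by rewrite mxE.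
  rewrite mulmx0; apply: dot_self_le0.
  have : 0 <= dot c (- c) by apply: Mc => -[].
  by rewrite dotNr oppr_ge0.
rewrite -[k.+1]/(1 + k)%N in M *.
have [a [B ->]] : exists a : 'cV_n, exists B, M = col_mx a^T B.
  by exists (usubmx M)^T, (dsubmx M); rewrite trmxK vsubmxK.
move=> Mc.
have nonneg_col d : 0 <= dot a d -> nonneg (B *m d) ->
    nonneg (col_mx a^T B *m d).
  move=> ad Bd; rewrite mul_col_mx; apply: nonneg_col_mx => // i.
  by rewrite ord1.
have [Bc|] := pselect (forall d, nonneg (B *m d) -> 0 <= dot c d).
  have [w w0 cw] := IH _ _ _ Bc; exists (col_mx 0 w).
    by apply: nonneg_col_mx => // i; rewrite mxE.
  by rewrite tr_col_mx mul_row_col mulmx0 add0r.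
move=> /existsNP[x1 /not_implyP[Bx1 /negP]]; rewrite -ltNge => cx1.
have ax1 : dot a x1 < 0.
  rewrite ltNge; apply/negP => ax1.
  by have := Mc _ (nonneg_col _ ax1 Bx1); rewrite leNgt cx1.
pose x0 := (- dot a x1)^-1 *: x1.
have x1p : 0 < (- dot a x1)^-1 by rewrite invr_gt0 oppr_gt0.
have ax0 : dot a x0 = -1.
  by rewrite dotZr invrN mulNr mulVf ?lt_eqF.
have cx0 : dot c x0 < 0 by rewrite dotZr pmulr_rlt0.
have Bx0 : nonneg (B *m x0).
  by move=> i; rewrite -scalemxAr mxE mulr_ge0// ltW.
pose P := 1%:M + x0 *m a^T.
have PE d : P *m d = d + dot a d *: x0.
  by rewrite mulmxDl mul1mx -mulmxA [a^T *m d]mx11_scalar mul_mx_scalar.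
have [d Bd|w w0 cw] := IH _ (B *m P) (P^T *m c).
  rewrite dot_trmx_mull; apply: Mc; apply: nonneg_col; last by rewrite mulmxA.
  by rewrite PE dotDr dotZr ax0 mulrN1 subrr.
(* Since [P^T v = v + (v . x0) a], the identity [P^T c = P^T (B^T w)] solved for [c] leaves exactly
   this coefficient on [a]; it is nonnegative because [w . B x0 >= 0 > c . x0]. *)
exists (col_mx (const_mx (dot w (B *m x0) - dot c x0)) w).
  apply: nonneg_col_mx => // i; rewrite mxE subr_ge0 (le_trans (ltW cx0))//.
  exact: dot_ge0.
have PT (v : 'cV_n) : P^T *m v = v + dot v x0 *: a.
  rewrite /P linearD /= trmx1 trmx_mul trmxK mulmxDl mul1mx -mulmxA.
  by rewrite [x0^T *m v]mx11_scalar mul_mx_scalar [dot v x0]dotC.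
move: cw; rewrite trmx_mul -mulmxA !PT dot_trmx_mull => cw.
rewrite tr_col_mx trmxK mul_row_col [const_mx _]mx11_scalar mul_mx_scalar.
by rewrite mxE scalerBl addrAC [_ *: a + _]addrC -cw addrK.
Qed.

(* Applying Farkas to M and -c with target - 1^T M gives
   tau c = M^T (w + 1), and the other combination c = M^T w0 makes the
   multiplier 1 + tau of c nonzero. *)
Lemma farkas_strict {k n : nat} (M : 'M[R]_(k, n)) (c : 'cV[R]_n) :
  (forall d, nonneg (M *m d) -> dot c d <= 0 -> M *m d = 0 /\ dot c d = 0) ->
  exists2 w, pos w & c = M^T *m w.
Proof.
move=> Mc.
have [|w0 w0p cw0] := @farkas k n M c.
  move=> d Md; have [//|cd] := leP 0 (dot c d).
  by have [_ cd0] := Mc _ Md (ltW cd); rewrite cd0 ltxx in cd.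
(* The extra row [- c^T] encodes [dot c d <= 0]; on this smaller cone [M d = 0], so the target
   functional vanishes there. *)
have [d|w wp] := @farkas (k + 1) n (col_mx M (- c^T)) (- (M^T *m const_mx 1)).
  rewrite mul_col_mx mulNmx => Mcd.
  have [||Md0 _] := Mc d.
  - by move=> i; have := Mcd (lshift 1 i); rewrite col_mxEu.
  - by have := Mcd (rshift k 0); rewrite col_mxEd mxE oppr_ge0.
  by rewrite dotNl dot_trmx_mull Md0 dot0r oppr0.
rewrite -[w]vsubmxK tr_col_mx mul_row_col.
set v := usubmx w; set t := dsubmx w => e.
have t0 : 0 <= t 0 0 by rewrite mxE.
have v0 : nonneg v by move=> i; rewrite mxE.
have tE : (- c^T)^T *m t = - (t 0 0 *: c).
  by rewrite linearN /= trmxK mulNmx [in LHS](mx11_scalar t) mul_mx_scalar.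
exists ((1 + t 0 0)^-1 *: (w0 + v + const_mx 1)) => [i|].
  rewrite mxE mulr_gt0 ?invr_gt0 ?ltr_wpDr// mxE [const_mx _ _ _]mxE.
  by rewrite ltr_wpDl// mxE addr_ge0// v0.
have t1 : 1 + t 0 0 != 0 by rewrite gt_eqF// ltr_wpDr.
rewrite -scalemxAr !mulmxDr -cw0.
apply: (scalerI t1); rewrite scalerA mulfV// scale1r scalerDl scale1r.
rewrite -addrA; congr (_ + _).
by rewrite -[X in _ + X]opprK e tE opprB addrC subrK.
Qed.

End Farkas.

(** * Dual certificates for a linear form plus a 1-norm on a cone *)

Section Certificates.
Context {R : realType}.

(* Encodes A d = 0, B d >= 0, |F d| <= s (entrywise) in (d, s). *)
Definition epigraph_mx {m p q n : nat} (A : 'M[R]_(m, n)) (B : 'M[R]_(p, n))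
    (F : 'M[R]_(q, n)) : 'M[R]_(m + m + (p + (q + q)), n + q) :=
  col_mx (col_mx (row_mx A 0) (row_mx (- A) 0))
    (col_mx (row_mx B 0) (col_mx (row_mx (- F) 1%:M) (row_mx F 1%:M))).

Lemma epigraph_mxE {m p q n : nat} (A : 'M[R]_(m, n)) (B : 'M[R]_(p, n))
    (F : 'M[R]_(q, n)) (d : 'cV_n) (s : 'cV_q) :
  epigraph_mx A B F *m col_mx d s =
  col_mx (col_mx (A *m d) (- (A *m d)))
    (col_mx (B *m d) (col_mx (s - F *m d) (s + F *m d))).
Proof.
rewrite !mul_col_mx !mul_row_col !mul0mx !mul1mx !mulNmx !addr0.
by rewrite [- _ + s]addrC [F *m d + s]addrC.
Qed.

Lemma nonneg_epigraph {m p q n : nat} (A : 'M[R]_(m, n)) (B : 'M[R]_(p, n))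
    (F : 'M[R]_(q, n)) (d : 'cV_n) (s : 'cV_q) :
  nonneg (epigraph_mx A B F *m col_mx d s) ->
  [/\ A *m d = 0, nonneg (B *m d) & norm1 (F *m d) <= dot (const_mx 1) s].
Proof.
rewrite epigraph_mxE; move: (A *m d) (B *m d) (F *m d) => a b f h; split.
- apply/matrixP => i j; rewrite ord1 mxE; apply/eqP; rewrite eq_le.
  have := h (lshift _ (rshift _ i)); have := h (lshift _ (lshift _ i)).
  by rewrite !col_mxEu col_mxEd mxE oppr_ge0 => -> ->.
- by move=> i; have := h (rshift _ (lshift _ i)); rewrite col_mxEd col_mxEu.
rewrite dotE; apply: ler_sum => i _; rewrite mxE mul1r ler_norml.
have := h (rshift _ (rshift _ (lshift _ i))).
have := h (rshift _ (rshift _ (rshift _ i))).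
by rewrite !col_mxEd col_mxEu !mxE; lra.
Qed.

(** The two sign-constrained multipliers of [A d = 0] merge into a free [u]. The columns of the
    slacks give [f + g = 1], so [f - g] lies in the unit sup-norm ball, in its interior when signs
    are strict. [P] stands for either sign condition. *)
Lemma epigraph_dual {m p q n : nat} (P : R -> Prop) (A : 'M[R]_(m, n))
    (B : 'M[R]_(p, n)) (F : 'M[R]_(q, n)) (c : 'cV_n) (w : 'cV_(m + m + (p + (q + q)))) :
  (forall i, P (w i 0)) ->
  col_mx c (const_mx 1) = (epigraph_mx A B F)^T *m w ->
  exists u, exists b : 'cV_p, exists f : 'cV_q, exists g : 'cV_q,
    [/\ forall i, P (b i 0), forall i, P (f i 0), forall i, P (g i 0),
        f + g = const_mx 1 & c + F^T *m (f - g) = A^T *m u + B^T *m b].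
Proof.
rewrite -[w]vsubmxK -[usubmx w]vsubmxK -[dsubmx w]vsubmxK.
rewrite -[dsubmx (dsubmx w)]vsubmxK.
set a := usubmx (usubmx w); set a' := dsubmx (usubmx w).
set b := usubmx (dsubmx w).
set f := usubmx (dsubmx (dsubmx w)); set g := dsubmx (dsubmx (dsubmx w)).
move=> Pw; rewrite !tr_col_mx !mul_row_col !tr_row_mx !mul_col_mx.
rewrite !trmx0 !mul0mx !trmx1 !mul1mx !add_col_mx !add0r.
move=> /eq_col_mx[-> fg]; exists (a - a'), b, f, g; split => //.
- by move=> i; have := Pw (rshift _ (lshift _ i)); rewrite col_mxEd col_mxEu.
- move=> i; have := Pw (rshift _ (rshift _ (lshift _ i))).
  by rewrite !col_mxEd col_mxEu.
- move=> i; have := Pw (rshift _ (rshift _ (rshift _ i))).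
  by rewrite !col_mxEd.
rewrite !linearN /= !mulNmx !mulmxBr; apply/matrixP => i j.
move: (A^T *m a) (A^T *m a') (B^T *m b) (F^T *m f) (F^T *m g) => a1 a2 b1 f1 f2.
rewrite !mxE; ring.
Qed.

(** Any admissible slack satisfies [1 . s >= norm1 (F d)], so the hypothesis makes the linear form
    [c . d + 1 . s] nonnegative on the epigraph cone, and Farkas' lemma applies. *)
Lemma cone_certificate {m p q n : nat} (A : 'M[R]_(m, n)) (B : 'M[R]_(p, n))
    (F : 'M[R]_(q, n)) (c : 'cV_n) :
  (forall d, A *m d = 0 -> nonneg (B *m d) -> 0 <= dot c d + norm1 (F *m d)) ->
  exists u, exists w : 'cV_p, exists f : 'cV_q, [/\ nonneg w, norm_inf f <= 1 &
    c + F^T *m f = A^T *m u + B^T *m w].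
Proof.
move=> h.
have [d|w w0 /(epigraph_dual (>= 0) _ _ _ _ _ w0)] :=
    farkas (epigraph_mx A B F) (col_mx c (const_mx 1)).
  rewrite -[d]vsubmxK => /nonneg_epigraph[Ad Bd Fs].
  by rewrite dot_col_mx (le_trans (h _ Ad Bd))// lerD2l.
move=> [u [b [f [g [b0 f0 g0 fg e]]]]]; exists u, b, (f - g); split => //.
apply: norm_inf_le => // i.
have := congr1 (fun v : 'cV_q => v i 0) fg; rewrite /= !mxE => fgi.
by rewrite ler_norml; have := f0 i; have := g0 i; lra.
Qed.

Lemma cone_certificate_strict {m p q n : nat} (A : 'M[R]_(m, n))
    (B : 'M[R]_(p, n)) (F : 'M[R]_(q, n)) (c : 'cV_n) :
  (forall d, A *m d = 0 -> nonneg (B *m d) -> dot c d + norm1 (F *m d) <= 0 ->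
    d = 0) ->
  exists u, exists w : 'cV_p, exists f : 'cV_q, [/\ pos w, norm_inf f < 1 &
    c + F^T *m f = A^T *m u + B^T *m w].
Proof.
move=> h.
have [d|w w0 /(epigraph_dual (> 0) _ _ _ _ _ w0)] :=
    farkas_strict (epigraph_mx A B F) (col_mx c (const_mx 1)).
  rewrite -[d]vsubmxK => Md; have [Ad Bd Fs] := nonneg_epigraph _ _ _ _ _ Md.
  rewrite dot_col_mx => cs.
  have d0 : usubmx d = 0 by apply: h => //; rewrite (le_trans _ cs)// lerD2l.
  (* At [d = 0] the constraints read [s >= 0], while [cs] bounds the sum of [s] by 0. *)
  have s0 : dsubmx d = 0.
    apply: (@dot_pos_eq0 _ _ (const_mx 1)) => [i|i|]; first by rewrite mxE.
      move: Md; rewrite epigraph_mxE d0 !mulmx0 subr0.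
      by move=> /(_ (rshift _ (rshift _ (lshift _ i)))); rewrite !col_mxEd col_mxEu.
    by move: cs; rewrite d0 dot0r add0r.
  by rewrite d0 s0 col_mx0 mulmx0 !dot0r addr0.
move=> [u [b [f [g [b0 f0 g0 fg e]]]]]; exists u, b, (f - g); split => //.
apply: norm_inf_lt => // i.
have := congr1 (fun v : 'cV_q => v i 0) fg; rewrite /= !mxE => fgi.
by rewrite ltr_norml; have := f0 i; have := g0 i; lra.
Qed.

End Certificates.

(** * Restriction to index sets and kernels of submatrices *)

Section Restriction.
Context {R : realType}.

Lemma norm1_rows {n : nat} (beta : {set 'I_n}) (v : 'cV[R]_n) :
  norm1 (rows beta v) = \sum_(i in beta) `|v i 0|.
Proof. by rewrite big_enum_val; apply: eq_bigr => i _; rewrite mxE. Qed.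

Lemma sum_setC {n : nat} (beta : {set 'I_n}) (f : 'I_n -> R) :
  \sum_i f i = \sum_(i in beta) f i + \sum_(i in ~: beta) f i.
Proof.
by rewrite (bigID (mem beta)) /=; congr (_ + _); apply: eq_bigl => i; rewrite inE.
Qed.

Lemma mulmx_split {m n : nat} (beta : {set 'I_n}) (M : 'M[R]_(m, n))
    (d : 'cV[R]_n) :
  M *m d = cols beta M *m rows beta d + cols (~: beta) M *m rows (~: beta) d.
Proof.
apply/matrixP => i j; rewrite !mxE (sum_setC beta).
by congr (_ + _); rewrite big_enum_val; apply: eq_bigr => k _; rewrite !mxE.
Qed.

Lemma trmx_cols {m n : nat} (beta : {set 'I_n}) (M : 'M[R]_(m, n)) :
  (cols beta M)^T = rows beta M^T.
Proof. by apply/matrixP => i j; rewrite !mxE. Qed.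

Lemma trmx_rows_eye {n : nat} (beta : {set 'I_n}) :
  (rows beta 1%:M)^T = cols beta 1%:M :> 'M[R]_(_, _).
Proof. by apply/matrixP => i j; rewrite !mxE eq_sym. Qed.

Lemma rows_eye_mul {n : nat} (beta : {set 'I_n}) (d : 'cV[R]_n) :
  rows beta 1%:M *m d = rows beta d.
Proof. by rewrite rows_mul mul1mx. Qed.

(** The transposed row selector pads [w] by zeros; this turns the block vector of (ii) into a sum of
    two matrix products. *)
Lemma assemble_rowsD {n : nat} (beta : {set 'I_n}) (v : 'cV[R]_n) w :
  assemble (rows beta v) (rows (~: beta) v + w) =
  v + (rows (~: beta) 1%:M)^T *m w.
Proof.
rewrite /assemble mulmxDr addrA !trmx_rows_eye -mulmx_split.
by rewrite mul1mx.
Qed.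

(** Off its support [x] is zero, so the difference is [z] there: feasible displacements lie in the
    cone of the argument. *)
Lemma nonneg_rows_compl_supp {n : nat} (x z : 'cV[R]_n) :
  nonneg z -> nonneg (rows (~: supp x) (z - x)).
Proof.
move=> z0 i; rewrite !mxE.
by have := enum_valP i; rewrite !inE negbK => /eqP ->; rewrite subr0.
Qed.

Lemma full_column_rankP {p q : nat} (K : 'M[R]_(p, q)) :
  full_column_rank K <-> forall v : 'cV_q, K *m v = 0 -> v = 0.
Proof.
rewrite /full_column_rank -mxrank_tr; split=> [/eqP Kf v Kv|Kinj].
  apply: trmx_inj; apply: (row_free_inj Kf).
  by rewrite /= -trmx_mul Kv !trmx0 mul0mx.
apply/eqP/inj_row_free => v vK; apply: trmx_inj; rewrite trmx0; apply: Kinj.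
by apply: trmx_inj; rewrite trmx_mul trmxK vK trmx0.
Qed.

End Restriction.

(** * First-order behaviour of the 1-norm and of the orthant *)

Section Norm1Expansion.
Context {R : realType}.

(** The one-sided directional derivative of [norm1] at [v] along [e], split along the support so
    that the sign vector of the theorem appears. *)
Definition norm1_deriv {n : nat} (v e : 'cV[R]_n) : R :=
  dot (map_mx Num.sg (rows (supp v) v)) (rows (supp v) e)
  + norm1 (rows (~: supp v) e).

Lemma norm1_derivE {n : nat} (v e : 'cV[R]_n) :
  norm1_deriv v e =
  \sum_i (if v i 0 == 0 then `|e i 0| else Num.sg (v i 0) * e i 0).
Proof.
rewrite /norm1_deriv dotE norm1_rows (sum_setC (supp v)); congr (_ + _).
  rewrite [RHS]big_enum_val; apply: eq_bigr => i _; rewrite !mxE.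
  by have := enum_valP i; rewrite inE => /negPf ->.
by apply: eq_bigr => i; rewrite !inE negbK => ->.
Qed.

(** Entrywise, [|a + b| >= sg a * (a + b) = |a| + sg a * b] for nonzero [a], with equality of the
    two sides when [a = 0] contributes [|b|]. *)
Lemma norm1D_ge {n : nat} (v e : 'cV[R]_n) :
  norm1 v + norm1_deriv v e <= norm1 (v + e).
Proof.
rewrite norm1_derivE -big_split /=; apply: ler_sum => i _; rewrite mxE.
case: eqP => [->|/eqP v0]; first by rewrite normr0 !add0r.
rewrite normrEsg -mulrDr (le_trans (ler_norm _))// normrM.
by rewrite normr_sg v0 mul1r.
Qed.

Lemma exists_step {n : nat} (v e : 'cV[R]_n) :
  exists2 t : R, 0 < t & forall s i, 0 <= s <= t -> v i 0 != 0 ->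
    s * `|e i 0| <= `|v i 0|.
Proof.
(* [r] dominates every ratio; division by zero yields 0, so zero entries of [v] add nothing. The
   summand 1 in [1 + r] keeps the step finite. *)
pose r := \sum_i `|e i 0| / `|v i 0|.
have r1 : 0 < 1 + r by rewrite ltr_wpDr// sumr_ge0// => i _; rewrite divr_ge0.
exists (1 + r)^-1 => [|s i /andP[s0 st] v0]; first by rewrite invr_gt0.
rewrite (le_trans (ler_wpM2r _ st))// mulrC ler_pdivrMr// mulrC.
rewrite -ler_pdivrMr ?normr_gt0// /r (bigD1 i)//= addrCA lerDl.
by rewrite addr_ge0// sumr_ge0// => j _; rewrite divr_ge0.
Qed.

(** Within the step of [exists_step] no nonzero entry crosses 0, so each absolute value is affine in
    [s]. *)
Lemma norm1D_step {n : nat} (v e : 'cV[R]_n) :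
  exists2 t : R, 0 < t & forall s, 0 <= s <= t ->
    norm1 (v + s *: e) = norm1 v + s * norm1_deriv v e.
Proof.
have [t t0 ht] := exists_step v e; exists t => // s st.
rewrite norm1_derivE mulr_sumr -big_split /=; apply: eq_bigr => i _.
rewrite !mxE; case: eqP => [->|/eqP v0].
  by case/andP: st => s0 _; rewrite normr0 !add0r normrM ger0_norm.
have := ht s i st v0; case/andP: st => s0 _.
rewrite -[in X in X -> _](ger0_norm s0) -normrM; move: v0.
set a := v i 0; set b := s * e i 0 => v0; rewrite mulrCA -/b => ab.
have := lerNnormlW ab; have := ler_normlW ab.
have [a0|a0|/eqP] := ltgtP a 0; last by rewrite (negPf v0).
  by rewrite (ltr0_norm a0) ltr0_sg// => ? ?; rewrite ler0_norm; lra.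
by rewrite (gtr0_norm a0) gtr0_sg// => ? ?; rewrite ger0_norm; lra.
Qed.

Lemma nonneg_step {n : nat} (x d : 'cV[R]_n) :
  nonneg x -> nonneg (rows (~: supp x) d) ->
  exists2 t : R, 0 < t & forall s, 0 <= s <= t -> nonneg (x + s *: d).
Proof.
move=> x0 d0; have [t t0 ht] := exists_step x d; exists t => // s st i.
rewrite !mxE; have [xi|xi] := eqVneq (x i 0) 0.
  have iS : i \in ~: supp x by rewrite !inE xi eqxx.
  have := d0 (enum_rank_in iS i); rewrite mxE enum_rankK_in// xi add0r.
  by case/andP: st => s0 _; exact: mulr_ge0.
have := ht s i st xi; rewrite (ger0_norm (x0 i)).
case/andP: st => s0 _; rewrite -[in X in X -> _](ger0_norm s0) -normrM.
by move/lerNnormlW; lra.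
Qed.

End Norm1Expansion.

(** * Expansion of the objective and first-order necessary conditions *)

Section FusedLassoObjective.
Context {R : realType}.

Lemma norm1_fusedE {N : nat} (l1 l2 : R) (x : 'cV[R]_N) :
  0 < l1 -> 0 < l2 ->
  norm1 (fusedE N l1 l2 *m x) = l1 * norm1 x + l2 * norm1 (D1 N *m x).
Proof.
move=> l10 l20; rewrite mul_col_mx norm1_col_mx -!scalemxAl mul1mx !norm1Z.
by rewrite !gtr0_norm.
Qed.

(** Positive weights do not change which entries vanish, so the cosupport of [E x] is the disjoint
    union of those of [x] and [D1 x]. *)
Lemma fusedE_cosupp {N : nat} (l1 l2 : R) (x d : 'cV[R]_N) :
  0 < l1 -> 0 < l2 ->
  rows (~: supp (fusedE N l1 l2 *m x)) (fusedE N l1 l2 *m d) = 0 <->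
  rows (~: supp x) d = 0 /\ rows (~: supp (D1 N *m x)) (D1 N *m d) = 0.
Proof.
move=> l10 l20.
have rows0 n (v w : 'cV[R]_n) : rows (~: supp v) w = 0 <->
    forall i, v i 0 = 0 -> w i 0 = 0.
  split=> [h i vi|h]; last first.
    apply/matrixP => i j; rewrite ord1 !mxE; apply: h.
    by have := enum_valP i; rewrite !inE negbK => /eqP.
  have iS : i \in ~: supp v by rewrite !inE vi eqxx.
  have := congr1 (fun u : 'cV_#|_| => u (enum_rank_in iS i) 0) h.
  by rewrite /= !mxE enum_rankK_in.
have scale0 (l a : R) : 0 < l -> l * a = 0 <-> a = 0.
  move=> l0; split=> [/eqP|->]; last by rewrite mulr0.
  by rewrite mulf_eq0 gt_eqF// => /eqP.
rewrite !rows0 !mul_col_mx -!scalemxAl !mul1mx.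
split=> [h|[h1 h2] i].
  split=> i xi.
    have := h (lshift _ i); rewrite !col_mxEu [_ i 0]mxE [(_ *: d) i 0]mxE.
    by rewrite !scale0//; exact.
  have := h (rshift _ i).
  rewrite !col_mxEd [_ i 0]mxE [(_ *: (_ *m d)) i 0]mxE.
  by rewrite !scale0//; exact.
case: (split_ordP i) => j ->.
  by rewrite !col_mxEu [_ j 0]mxE [(_ *: d) j 0]mxE !scale0//; exact: h1.
rewrite !col_mxEd [_ j 0]mxE [(_ *: (_ *m d)) j 0]mxE.
by rewrite !scale0//; exact: h2.
Qed.

Lemma objectiveD {m N : nat} (A : 'M[R]_(m, N)) (y : 'cV_m) (l1 l2 : R)
    (x d : 'cV[R]_N) :
  0 < l1 -> 0 < l2 ->
  objective A y l1 l2 (x + d) =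
  objective A y l1 l2 x + dot (2 *: (A^T *m (A *m x - y))) d
  + dot (A *m d) (A *m d)
  + (norm1 (fusedE N l1 l2 *m x + fusedE N l1 l2 *m d)
     - norm1 (fusedE N l1 l2 *m x)).
Proof.
move=> l10 l20; rewrite /objective -mulmxDr !norm1_fusedE// !norm2_sqr.
rewrite dotZl dot_trmx_mull [A *m (x + d)]mulmxDr [_ + _ - y]addrAC.
move: (A *m x - y) (A *m d) => r a; rewrite dotDl !dotDr [dot a r]dotC.
ring.
Qed.

Lemma objectiveD_ge {m N : nat} (A : 'M[R]_(m, N)) (y : 'cV_m) (l1 l2 : R)
    (x d : 'cV[R]_N) :
  0 < l1 -> 0 < l2 ->
  objective A y l1 l2 x + (dot (2 *: (A^T *m (A *m x - y))) d
    + norm1_deriv (fusedE N l1 l2 *m x) (fusedE N l1 l2 *m d))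
    + dot (A *m d) (A *m d) <= objective A y l1 l2 (x + d).
Proof.
move=> l10 l20; rewrite objectiveD//.
by have := norm1D_ge (fusedE N l1 l2 *m x) (fusedE N l1 l2 *m d); lra.
Qed.

Lemma objectiveD_step {m N : nat} (A : 'M[R]_(m, N)) (y : 'cV_m) (l1 l2 : R)
    (x d : 'cV[R]_N) :
  0 < l1 -> 0 < l2 -> nonneg x -> nonneg (rows (~: supp x) d) ->
  exists2 t : R, 0 < t & forall s, 0 <= s <= t ->
    nonneg (x + s *: d) /\
    objective A y l1 l2 (x + s *: d) = objective A y l1 l2 x
      + s * (dot (2 *: (A^T *m (A *m x - y))) d
             + norm1_deriv (fusedE N l1 l2 *m x) (fusedE N l1 l2 *m d))
      + s ^+ 2 * dot (A *m d) (A *m d).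
Proof.
move=> l10 l20 x0 d0; have [t1 t10 h1] := nonneg_step x d x0 d0.
have [t2 t20 h2] := norm1D_step (fusedE N l1 l2 *m x) (fusedE N l1 l2 *m d).
exists (Num.min t1 t2) => [|s]; first by rewrite lt_min t10.
rewrite le_min => /and3P[s0 s1 s2]; split; first by apply: h1; rewrite s0.
rewrite objectiveD// -!scalemxAr h2 ?s0// !dotZr !dotZl.
ring.
Qed.

Lemma minimizer_deriv_ge0 {m N : nat} (A : 'M[R]_(m, N)) (y : 'cV_m)
    (l1 l2 : R) (x d : 'cV[R]_N) :
  0 < l1 -> 0 < l2 -> minimizer A y l1 l2 x -> nonneg (rows (~: supp x) d) ->
  0 <= dot (2 *: (A^T *m (A *m x - y))) d
       + norm1_deriv (fusedE N l1 l2 *m x) (fusedE N l1 l2 *m d).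
Proof.
move=> l10 l20 [x0 xmin] d0.
have [t t0 ht] := objectiveD_step A y l1 l2 x d l10 l20 x0 d0.
move: ht; set g := _ + norm1_deriv _ _; set q := dot _ (A *m d) => ht.
have q0 : 0 <= q by exact: dot_self_ge0.
rewrite leNgt; apply/negP => g0.
(* A step [s <= r] gives [g + s * q <= - s < 0], so the objective would strictly decrease. *)
pose r := - g / (1 + q).
have r0 : 0 < r by rewrite divr_gt0 ?oppr_gt0// ltr_wpDr.
pose s := Num.min t r.
have s0 : 0 < s by rewrite lt_min t0.
have [|zs zE] := ht s; first by rewrite ltW// ge_min lexx.
have := xmin _ zs; rewrite zE -addrA lerDl expr2 -mulrA -mulrDr.
rewrite pmulr_rge0// => gsq.
have : s * (1 + q) <= - g.
  by rewrite -ler_pdivlMr ?ltr_wpDr// ge_min lexx orbT.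
by rewrite mulrDr mulr1; lra.
Qed.

(** When [A d = 0] the gradient and quadratic terms vanish, so a small step along [d] does not raise
    the objective; it reaches another minimizer unless [d = 0]. *)
Lemma unique_minimizer_deriv_gt0 {m N : nat} (A : 'M[R]_(m, N)) (y : 'cV_m)
    (l1 l2 : R) (x d : 'cV[R]_N) :
  0 < l1 -> 0 < l2 -> unique_minimizer A y l1 l2 x ->
  A *m d = 0 -> nonneg (rows (~: supp x) d) ->
  norm1_deriv (fusedE N l1 l2 *m x) (fusedE N l1 l2 *m d) <= 0 -> d = 0.
Proof.
move=> l10 l20 [[x0 xmin] xuniq] Ad d0 g0.
have [t t0 ht] := objectiveD_step A y l1 l2 x d l10 l20 x0 d0.
have [|zt zE] := ht t; first by rewrite ltW/=.
have /xuniq/eqP : minimizer A y l1 l2 (x + t *: d).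
  split=> // w w0; apply: le_trans (xmin _ w0).
  rewrite zE dotZl dot_trmx_mull Ad !dot0r !mulr0 add0r addr0 gerDl.
  by rewrite pmulr_rle0.
rewrite -subr_eq0 addrAC subrr add0r scaler_eq0 gt_eqF//.
by move/eqP.
Qed.

Lemma norm1_deriv_mul {p n : nat} (E : 'M[R]_(p, n)) (x d : 'cV[R]_n) :
  let S := supp (E *m x) in
  norm1_deriv (E *m x) (E *m d) =
  dot ((rows S E)^T *m map_mx Num.sg (rows S (E *m x))) d
  + norm1 (rows (~: S) E *m d).
Proof. by rewrite /= dot_trmx_mull !rows_mul. Qed.

End FusedLassoObjective.

(** * Equivalence of uniqueness with the three conditions *)

Theorem corollary5p1 (R : realType) (m N : nat) (hN : (0 < N)%N)
  (A : 'M[R]_(m, N)) (y : 'cV[R]_m) (l1 l2 : R) (hl1 : 0 < l1) (hl2 : 0 < l2)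
  (xs : 'cV[R]_N) (hxs : nonneg xs) :
  let E := fusedE N l1 l2 in
  let S := supp (E *m xs) in
  let SI := supp xs in
  let SD := supp (D1 N *m xs) in
  let bhat := map_mx Num.sg (rows S (E *m xs)) in
  let b := (rows S E)^T *m bhat in
  unique_minimizer A y l1 l2 xs <->
  [/\ full_column_rank (col_mx (cols SI A) (submat (~: SD) SI (D1 N))),
      exists (u : 'cV[R]_m) (u' : 'cV[R]_#|~: SI|) (u'' : 'cV[R]_#|~: S|),
        [/\ pos u', norm_inf u'' < 1 &
            assemble ((cols SI A)^T *m u) ((cols (~: SI) A)^T *m u + u')
              - (rows (~: S) E)^T *m u'' = b]
    & exists (ut : 'cV[R]_#|~: SI|) (ut' : 'cV[R]_#|~: S|),
        [/\ nonneg ut, norm_inf ut' <= 1 &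
            2 *: (A^T *m (A *m xs - y)) - (rows (~: SI) 1%:M)^T *m ut
              + b + (rows (~: S) E)^T *m ut' = 0]].
Proof.
move=> E S SI SD bhat b.
pose B : 'M[R]_(_, N) := rows (~: SI) 1%:M; pose F := rows (~: S) E.
set q := 2 *: _.
have BE (d : 'cV_N) : B *m d = rows (~: SI) d by exact: rows_eye_mul.
have derivE d : norm1_deriv (E *m xs) (E *m d) = dot b d + norm1 (F *m d).
  exact: norm1_deriv_mul.
clearbody b.
have FE (d : 'cV_N) : F *m d = 0 <->
    B *m d = 0 /\ rows (~: SD) (D1 N *m d) = 0.
  by rewrite BE rows_mul; exact: fusedE_cosupp.
have asmE u u' : assemble ((cols SI A)^T *m u) ((cols (~: SI) A)^T *m u + u') =
    A^T *m u + B^T *m u'.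
  by rewrite !trmx_cols !rows_mul assemble_rowsD.
have kerE (v : 'cV_#|SI|) :
    col_mx (cols SI A) (submat (~: SD) SI (D1 N)) *m v = 0 <->
    cols SI A *m v = 0 /\ rows (~: SD) (cols SI (D1 N) *m v) = 0.
  rewrite mul_col_mx rows_mul; split=> [/eqP|[-> ->]]; last by rewrite col_mx0.
  by rewrite col_mx_eq0 => /andP[/eqP-> /eqP->].
split=> [xu|[rk [u [u' [u'' [u'0 u''1 ub]]]] [ut [ut' [ut0 ut'1 utb]]]]].
- have cone d : A *m d = 0 -> nonneg (B *m d) ->
      dot b d + norm1 (F *m d) <= 0 -> d = 0.
    rewrite BE -derivE; exact: (unique_minimizer_deriv_gt0 A y l1 l2 xs d hl1 hl2 xu).
  split.
  + apply/full_column_rankP => v /kerE[Av Dv].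
    (* Extension of [v] by zero off [SI], which turns a kernel vector of the matrix in (i) into a
       direction. *)
    pose d := (rows SI 1%:M)^T *m v.
    have dI : rows SI d = v by rewrite -rows_eye_mul mulmxA rows_eye_trmx mul1mx.
    have dIc : rows (~: SI) d = 0.
      rewrite -rows_eye_mul mulmxA rows_eye_disjoint ?mul0mx//.
      by rewrite -setI_eq0 setIC setICr.
    have dE p (M : 'M_(p, N)) : M *m d = cols SI M *m v.
      by rewrite (mulmx_split SI) dI dIc mulmx0 addr0.
    have Fd : F *m d = 0 by apply/FE; rewrite BE dE.
    have Bd : B *m d = 0 by rewrite BE.
    have n0 p : nonneg (0 : 'cV[R]_p) by move=> i; rewrite mxE.
    have norm0 p : norm1 (0 : 'cV[R]_p) = 0.
      by rewrite -[0](scale0r (0 : 'cV_p)) norm1Z normr0 mul0r.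
    suff d0 : d = 0 by rewrite -dI d0; apply/matrixP => i j; rewrite !mxE.
    (* As [A d], [B d] and [F d] all vanish, both [d] and [- d] are admissible, and [b] is
       nonpositive on one of them. *)
    have [bd|bd] := leP (dot b d) 0.
      by apply: cone; rewrite ?Fd ?norm0 ?addr0 ?Bd// dE.
    apply: oppr_inj; rewrite oppr0; apply: cone.
    * by rewrite mulmxN dE Av oppr0.
    * by rewrite mulmxN Bd oppr0.
    * by rewrite mulmxN Fd oppr0 norm0 addr0 dotNr oppr_le0 ltW.
  + have [u [w [f [w0 f1 e]]]] := cone_certificate_strict A B F b cone.
    exists u, w, f; split => //.
    by apply/eqP; rewrite asmE subr_eq -e.
  (* A matrix without rows makes the equality constraint void: optimality concerns the whole cone
     [B d >= 0], not only the kernel of [A]. *)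
  + have [d _ Bd|u [w [f [w0 f1 e]]]] :=
        cone_certificate (0 : 'M[R]_(0, N)) B F (q + b).
      rewrite dotDl -addrA -derivE; apply: minimizer_deriv_ge0 => //.
        by case: xu.
      by rewrite -BE.
    exists w, f; split => //.
    rewrite trmx0 mul0mx add0r in e.
    by rewrite [q - _ + b]addrAC [LHS]addrAC e subrr.
(* Pairing (iii) with [d] gives [(q + b) . d = ut . B d - ut' . F d], which is at least
   [- norm1 (F d)]. *)
have deriv_ge0 d : nonneg (B *m d) -> 0 <= dot q d + norm1_deriv (E *m xs) (E *m d).
  move=> Bd; have := congr1 (fun v => dot v d) utb.
  rewrite /= !dotDl dotNl !dot_trmx_mull -/B -/F [dot 0 d]dotC dot0r derivE.
  have := dot_ge0 _ _ ut0 Bd; have := dot_le_norm ut' (F *m d).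
  have := ler_wpM2r (norm1_ge0 (F *m d)) ut'1; rewrite mul1r.
  by lra.
have xmin : minimizer A y l1 l2 xs.
  split=> // z z0; rewrite -[z](subrKC xs).
  apply: le_trans (objectiveD_ge _ _ _ _ _ _ hl1 hl2).
  rewrite -addrA lerDl addr_ge0 ?dot_self_ge0// deriv_ge0// BE.
  exact: nonneg_rows_compl_supp.
split=> // z [z0 zmin]; apply/eqP; rewrite -subr_eq0; apply/eqP.
set d := z - xs.
have zE : z = xs + d by rewrite addrC subrK.
have Bd : nonneg (B *m d) by rewrite BE; exact: nonneg_rows_compl_supp.
have := objectiveD_ge A y l1 l2 xs d hl1 hl2; rewrite -zE.
have := zmin _ hxs; have := deriv_ge0 _ Bd; have := dot_self_ge0 (A *m d).
rewrite -/E -/q => h1 h2 h3 h4.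
(* Both minimizers have the same value, so the nonnegative slope and quadratic term along [d] must
   both vanish. *)
have Ad : A *m d = 0 by apply: dot_self_le0; lra.
have qd : dot q d = 0 by rewrite dotZl dot_trmx_mull Ad dot0r mulr0.
have : dot b d + norm1 (F *m d) <= 0 by rewrite -derivE; lra.
have -> : b = A^T *m u + B^T *m u' - F^T *m u'' by rewrite -ub asmE.
rewrite !dotDl dotNl !dot_trmx_mull Ad dot0r add0r => le0.
have ud := dot_ge0 _ _ (fun i => ltW (u'0 i)) Bd.
have uF := dot_le_norm u'' (F *m d).
(* With [b] replaced through (ii), [u' . B d - u'' . F d + norm1 (F d) <= 0]; the two bounds above
   leave [(1 - norm_inf u'') * norm1 (F d) <= 0]. *)
have F0 : F *m d = 0.
  apply: norm1_eq0; rewrite -(pmulr_rle0 _ (_ : 0 < 1 - norm_inf u'')) ?subr_gt0//.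
  by rewrite mulrBl mul1r; lra.
(* Now [d] lives on [SI], and its restriction is a kernel vector of the matrix in (i). *)
have [Bd0 Dd0] := (FE d).1 F0.
rewrite BE in Bd0.
have dE p (M : 'M_(p, N)) : M *m d = cols SI M *m rows SI d.
  by rewrite (mulmx_split SI) Bd0 mulmx0 addr0.
have dI : rows SI d = 0.
  by move/full_column_rankP: rk; apply; apply/kerE; rewrite -!dE.
by rewrite -[d]mul1mx dE dI mulmx0.
Qed.
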